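(* Let $G$ be a (finite, simple) graph with diameter $2$. Let $v$ and $w$ be distinct vertices of $G$, and let $d:=\min\{\deg(v),\deg(w)\}$. Then there are $d$ pairwise edge-disjoint paths between $v$ and $w$ in $G$, each of length (number of edges) at most $4$. *)

(* Defs.v *)
From mathcomp Require Import all_boot.

Set Implicit Arguments.
Unset Strict Implicit.
Unset Printing Implicit Defensive.

Definition simple_graph (V : finType) (e : rel V) : Prop :=
  symmetric e /\ irreflexive e.

Definition degree (V : finType) (e : rel V) (x : V) : nat := #|[set y | e x y]|.

(* As in MathComp's [path], the first vertex x is not stored in p, so the
   vertices of the path are x :: p and its number of edges is size p. *)
Definition graph_path (V : finType) (e : rel V) (x y : V) (p : seq V) : bool :=
  [&& path e x p, last x p == y & uniq (x :: p)].

Definition path_edges (V : finType) (x : V) (p : seq V) : seq {set V} :=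
  pairmap (fun a b => [set a; b]) x p.

Definition is_dist (V : finType) (e : rel V) (x y : V) (n : nat) : Prop :=
  (exists2 p, graph_path e x y p & size p = n) /\
  (forall p, graph_path e x y p -> n <= size p).

(* The maximum of all distances is attained and equals d; every distance being
   finite, the graph is connected. *)
Definition has_diameter (V : finType) (e : rel V) (d : nat) : Prop :=
  (forall x y, exists2 n, is_dist e x y n & n <= d) /\
  (exists x y, is_dist e x y d).

(* Main.v *)
Require Import Defs.
From mathcomp Require Import all_boot all_fingroup.

(** Common neighbours of [v] and [w], and the edge [vw] if present, give paths of
    length at most 2.  The remaining neighbours of [v] and of [w] are paired up
    so as to minimise the number of nonadjacent pairs [(a, b)]; each pair is
    joined by an edge or through a common neighbour [x], which is neither [v] nor
    [w].  If two of these links shared an edge, then the middle vertex of one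
    would be an end of the other, and exchanging the partners of the two pairs
    would create an adjacent pair, contradicting minimality. *)

Set Implicit Arguments.
Unset Strict Implicit.
Unset Printing Implicit Defensive.

Lemma set2_inj (T : finType) (a b c d : T) :
  [set a; b] = [set c; d] -> (a = c /\ b = d) \/ (a = d /\ b = c).
Proof.
move=> E.
have /set2P Ha : a \in [set c; d] by rewrite -E set21.
have /set2P Hb : b \in [set c; d] by rewrite -E set22.
have /set2P Hc : c \in [set a; b] by rewrite E set21.
have /set2P Hd : d \in [set a; b] by rewrite E set22.
by case: Ha Hb Hc Hd => [->|->] [->|->] [] ? [] ?; auto.
Qed.

(** Take [s] with the fewest unrelated pairs. If [r (f i) (g (s j))] held, exchanging the partners
    of [i] and [j] would repair the pair at [i] and alter no pair outside these two. *)
Lemma exists_unswappable_pairing (T : Type) (r : rel T) (m : nat)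
    (f g : 'I_m -> T) :
  exists s : 'S_m, forall i j, i != j ->
    ~~ r (f i) (g (s i)) -> ~~ r (f j) (g (s j)) -> ~~ r (f i) (g (s j)).
Proof.
pose cost (s : 'S_m) := \sum_i (~~ r (f i) (g (s i)) : nat).
have [s _ smin] := @arg_minnP _ 1%g predT cost isT.
exists s => i j ij ni nj; apply/negP => rij.
have := smin (tperm i j * s)%g isT.
have ji : j != i by rewrite eq_sym.
rewrite /cost (bigD1 i) //= (bigD1 j) //= [X in _ <= X](bigD1 i) //=.
rewrite [X in _ <= _ + X](bigD1 j) //= !permM tpermL tpermR ni nj rij /=.
rewrite [X in _ <= _ + (_ + X)](eq_bigr
    (fun k => ~~ r (f k) (g (s k)) : nat)) => [|k /andP[ki kj]].
  (* With the common terms cancelled, minimality claims 2 <= c, where c is the 0/1 cost of the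
     exchanged pair at [j]. *)
  by rewrite add0n addnA leq_add2r; case: (~~ _).
by rewrite permM tpermD // eq_sym.
Qed.

(** A shortest path has at most two edges; length 0 would give [a = b], and length 1 adjacency. *)
Lemma diameter2_common_neighbour (V : finType) (e : rel V) (a b : V) :
  has_diameter e 2 -> a != b -> ~~ e a b -> exists x, e a x && e x b.
Proof.
case=> /(_ a b) [n [[p /and3P[pp /eqP lp _] <-] _] sz] _ ab nab.
case: p pp lp sz => [|x [|y [|z p]]] //=.
- by move=> _ E; rewrite E eqxx in ab.
- by rewrite andbT => exa E; rewrite -E exa in nab.
by rewrite andbT => H <- _; exists x.
Qed.

Section EdgeDisjointPaths.

Variables (V : finType) (e : rel V) (v w : V).
Hypotheses (e_sym : symmetric e) (e_irr : irreflexive e).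
Hypotheses (diam2 : has_diameter e 2) (vw : v != w).

(* The neighbour [w] of [v], if it is one, counts as shared: it stands for the
   path of length one. *)
Let shared := [set y | e v y & e w y || (y == w)].
Let A := [set y | e v y & ~~ (e w y || (y == w))].
Let B := [set y | e w y & ~~ (e v y || (y == v))].
Let m := minn #|A| #|B|.

(** The neighbourhood of [v] splits into [shared] and [A], that of [w] into [shared'] and [B]. *)
Lemma min_degreeE : minn (degree e v) (degree e w) = #|shared| + m.
Proof.
pose shared' := [set y | e w y & e v y || (y == v)].
have -> : degree e v = #|shared| + #|A|.
  rewrite /degree -(cardsID [set y | e w y || (y == w)]).
  by congr (_ + _); apply: eq_card => y; rewrite !inE // andbC.
have -> : degree e w = #|shared'| + #|B|.
  rewrite /degree -(cardsID [set y | e v y || (y == v)]).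
  by congr (_ + _); apply: eq_card => y; rewrite !inE // andbC.
(* [w] lies in [shared], and [v] in [shared'], exactly when [v] and [w] are adjacent; without these
   two vertices, both sets consist of the common neighbours. *)
have -> : #|shared'| = #|shared|.
  rewrite (cardsD1 w shared) (cardsD1 v shared') !inE !eqxx !orbT !andbT e_sym.
  congr (_ + _); apply: eq_card => y; rewrite !inE.
  case: (eqVneq y v) => [->|_]; first by rewrite e_irr andbF.
  case: (eqVneq y w) => [->|_]; first by rewrite e_irr.
  by rewrite /= !orbF andbC.
by rewrite -addn_minr.
Qed.

Variables (a b : 'I_m -> V).
Hypotheses (a_inj : injective a) (b_inj : injective b).
Hypotheses (aA : forall i, a i \in A) (bB : forall i, b i \in B).
Hypothesis unswappable : forall i j, i != j ->
  ~~ e (a i) (b i) -> ~~ e (a j) (b j) -> ~~ e (a i) (b j).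

Lemma aP i : [/\ e v (a i), e w (a i) = false, a i != v & a i != w].
Proof.
have := aA i; rewrite inE negb_or => /and3P[ev /negPf ew ->].
by split=> //; apply: contraTneq ev => ->; rewrite e_irr.
Qed.

Lemma bP i : [/\ e w (b i), e v (b i) = false, b i != v & b i != w].
Proof.
have := bB i; rewrite inE negb_or => /and3P[ew /negPf ev ->].
by split=> //; apply: contraTneq ew => ->; rewrite e_irr.
Qed.

Lemma a_neq_b i j : a i != b j.
Proof. by have [ev _ _ _] := aP i; apply: contraTneq ev => ->; have [_ -> _ _] := bP j. Qed.

(** The default [v] is a mere placeholder: [link] uses [midpoint i] only when [a i] and [b i] are
    nonadjacent, and then a common neighbour exists. *)
Definition midpoint i := odflt v [pick x | e (a i) x && e x (b i)].

(** The midpoint avoids [v] and [w] because [v] is not adjacent to [b i], nor [w] to [a i]. *)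
Lemma midpointP i : ~~ e (a i) (b i) ->
  [/\ e (a i) (midpoint i), e (midpoint i) (b i), midpoint i != v & midpoint i != w].
Proof.
rewrite /midpoint => nab.
have [x0 hx0] := diameter2_common_neighbour diam2 (a_neq_b i i) nab.
case: pickP => [x /andP[ax xb]|/(_ x0)]; last by rewrite hx0.
split=> //=; first by apply: contraTneq xb => ->; have [_ -> _ _] := bP i.
by apply: contraTneq ax => ->; rewrite e_sym; have [_ -> _ _] := aP i.
Qed.

(** As in [graph_path], the starting vertex, here [a i], is left out. *)
Definition link i := if e (a i) (b i) then [:: b i] else [:: midpoint i; b i].

Definition short_path (k : {y | y \in shared} + 'I_m) : seq V :=
  match k with
  | inl y => if val y == w then [:: w] else [:: val y; w]
  | inr i => a i :: rcons (link i) w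
  end.

Definition first_vertex (k : {y | y \in shared} + 'I_m) : V :=
  match k with inl y => val y | inr i => a i end.

(** The vertex just before [w]; the one-edge path gets [v], so that [[set last_vertex k; w]] is the
    final edge in every case. *)
Definition last_vertex (k : {y | y \in shared} + 'I_m) : V :=
  match k with inl y => if val y == w then v else val y | inr i => b i end.

Lemma short_path_graph_path k : graph_path e v w (short_path k) /\ size (short_path k) <= 4.
Proof.
rewrite /graph_path; case: k => [[y /= ys]|i] /=.
  move: ys; rewrite inE => /andP[ev]; case: (eqVneq y w) => [E _|yw] /=.
    by subst y; rewrite ev eqxx inE vw.
  rewrite orbF e_sym => ew; rewrite ev ew eqxx !inE !negb_or vw yw !andbT.
  by split=> //; apply: contraTneq ev => <-; rewrite e_irr.
have [ea wa av aw] := aP i; have [eb vb bv bw] := bP i; have ab := a_neq_b i i.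
rewrite /link; case: ifPn => [eab|nab] /=.
  rewrite ea eab e_sym eb eqxx !inE !negb_or vw aw bw ab.
  by rewrite eq_sym av eq_sym bv.
have [ax xb xv xw] := midpointP nab.
have xa : midpoint i != a i by apply: contraTneq ax => ->; rewrite e_irr.
have xb' : midpoint i != b i by apply: contraTneq xb => ->; rewrite e_irr.
rewrite ea ax xb e_sym eb eqxx !inE !negb_or vw aw bw ab xw xb'.
by rewrite eq_sym av eq_sym xv eq_sym bv eq_sym xa.
Qed.

(** [A] is disjoint from [shared], so no neighbour of [v] starts two paths. *)
Lemma first_vertex_inj : injective first_vertex.
Proof.
have sA y i : y \in shared -> y != a i.
  by apply: contraTneq => ->; have := aA i; rewrite !inE => /andP[-> /negPf->].
move=> [y|i] [z|j] /= E.
- by congr inl; apply: val_inj.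
- by have := sA _ j (valP y); rewrite /= E eqxx.
- by have := sA _ i (valP z); rewrite /= -E eqxx.
- by congr inr; apply: a_inj.
Qed.

(** The value [v] of the one-edge path cannot recur: shared vertices are neighbours of [v], and
    [b i] differs from [v]. Nor is [b i] shared, being nonadjacent to [v]. *)
Lemma last_vertex_inj : injective last_vertex.
Proof.
have sv y : y \in shared -> e v y by rewrite inE => /andP[].
have nv y : y \in shared -> v != y by move/sv; apply: contraTneq => <-; rewrite e_irr.
have sB y i : y \in shared -> (if y == w then v else y) != b i.
  have [_ vb bv _] := bP i => ys; case: ifP => _; first by rewrite eq_sym.
  by apply: contraTneq (sv _ ys) => ->; rewrite vb.
move=> [y|i] [z|j] /= E.
- congr inl; apply: val_inj; move: E => /=; do 2 case: eqP => [->|_] //.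
    by move=> E; have := nv _ (valP z); rewrite /= E eqxx.
  by move=> E; have := nv _ (valP y); rewrite /= E eqxx.
- by have := sB _ j (valP y); rewrite /= E eqxx.
- by have := sB _ i (valP z); rewrite /= -E eqxx.
- by congr inr; apply: b_inj.
Qed.

Lemma short_path_edgesP k E : E \in path_edges v (short_path k) ->
  [\/ E = [set v; first_vertex k], E = [set last_vertex k; w]
    | exists2 i, k = inr i & E \in path_edges (a i) (link i)].
Proof.
case: k => [[y ys]|i] /=.
  case: eqP => [yw|_] /=; rewrite !inE; first by move/eqP; constructor 1; rewrite yw.
  by case/orP => /eqP; [constructor 1 | constructor 2].
have -> : path_edges (a i) (rcons (link i) w)
    = rcons (path_edges (a i) (link i)) [set b i; w].
  by rewrite /link; case: ifP.
rewrite inE mem_rcons inE => /or3P[/eqP|/eqP|]; [by constructor 1|by constructor 2|].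
by constructor 3; exists i.
Qed.

Lemma link_edges_avoid i E :
  E \in path_edges (a i) (link i) -> (v \notin E) && (w \notin E).
Proof.
have [_ _ av aw] := aP i; have [_ _ bv bw] := bP i.
rewrite /link; case: ifPn => [_|/midpointP[_ _ xv xw]];
  rewrite !inE; last case/orP; move=> /eqP->; rewrite !inE !negb_or.
all: by rewrite !(eq_sym v) !(eq_sym w) ?av ?aw ?bv ?bw ?xv ?xw.
Qed.

(** The ends of distinct links all differ, so a common edge forces both links to have midpoints,
    with a midpoint of one equal to an end of the other. *)
Lemma link_edges_disjoint i j E : i != j ->
  E \in path_edges (a i) (link i) -> E \in path_edges (a j) (link j) -> False.
Proof.
move=> ij; have ji : j != i by rewrite eq_sym.
have aij : a i <> a j by move/a_inj/eqP; apply/negP.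
have bij : b i <> b j by move/b_inj/eqP; apply/negP.
have abij k l : a k <> b l by apply/eqP/a_neq_b.
(* [midpoint k] is adjacent to [a k], and [midpoint l] to [b l], whereas [a k] and [b l] are
   nonadjacent by [unswappable]. *)
have hyp k l : k != l -> ~~ e (a k) (b k) -> ~~ e (a l) (b l) ->
    midpoint k <> b l /\ midpoint l <> a k.
  move=> kl nk nl; have nkl := unswappable kl nk nl.
  have [ax _ _ _] := midpointP nk; have [_ xb _ _] := midpointP nl.
  by split=> E'; [rewrite E' (negPf nkl) in ax | rewrite E' (negPf nkl) in xb].
rewrite /link; case: ifPn => [_|ni]; case: ifPn => [_|nj].
(* In goal 4 both links have midpoints; using [hyp] in both orders keeps each midpoint off both ends
   of the other link. *)
4: have [H1 H2] := hyp _ _ ij ni nj; have [H3 H4] := hyp _ _ ji nj ni.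
all: rewrite !inE => H H'.
all: repeat match goal with
  | K : is_true (_ || _) |- _ => case/orP: K => K
  | K : is_true (_ == _) |- _ => move/eqP: K => K
  end.
all: rewrite H in H'; case: (set2_inj H') => -[K K'].
all: first [exact: (aij K) | exact: (bij K') | exact: (abij _ _ K)
  | exact: (abij _ _ (esym K')) | congruence].
Qed.

(** Edges are compared by kind: first edges differ by [first_vertex_inj], last edges by
    [last_vertex_inj], and link edges contain neither [v] nor [w]. *)
Lemma short_paths_edge_disjoint k l : k <> l ->
  [disjoint path_edges v (short_path k) & path_edges v (short_path l)].
Proof.
move=> kl; have vw' : v <> w by apply/eqP.
have avoid E i : E \in path_edges (a i) (link i) -> v \notin E /\ w \notin E.
  by move/link_edges_avoid/andP.
(* Such an edge would join [v] and [w], making [k'] the one-edge path; both paths then have [v] as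
   [last_vertex], hence coincide. *)
have first_last k' l' : k' <> l' -> [set v; first_vertex k'] <> [set last_vertex l'; w].
  move=> kl' /set2_inj[[Ev Ew]|[/vw' //]]; apply: kl'.
  case: k' Ev Ew => [y|i] /= Ev; last by have [_ _ _ /eqP] := aP i.
  move=> yw; apply: last_vertex_inj; by rewrite /= yw eqxx.
apply/pred0Pn => -[E /andP[/= Ek El]].
case: (short_path_edgesP Ek) => [E1|E1|[i ki Ei]];
  case: (short_path_edgesP El) => [E2|E2|[j lj Ej]].
- case: (set2_inj (etrans (esym E1) E2)) => -[K1 K2].
    by apply/kl/first_vertex_inj.
  by apply/kl/first_vertex_inj; rewrite K2 -K1.
- exact: (first_last _ _ kl (etrans (esym E1) E2)).
- by have [] := avoid _ _ Ej; rewrite E1 set21.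
- exact: (first_last _ _ (nesym kl) (etrans (esym E2) E1)).
- case: (set2_inj (etrans (esym E1) E2)) => -[K1 K2].
    by apply/kl/last_vertex_inj.
  by apply/kl/last_vertex_inj; rewrite K1 -K2.
- by have [_] := avoid _ _ Ej; rewrite E1 set22.
- by have [] := avoid _ _ Ei; rewrite E2 set21.
- by have [_] := avoid _ _ Ei; rewrite E2 set22.
- apply: (link_edges_disjoint _ Ei Ej).
  by apply/eqP => ij; apply: kl; rewrite ki lj ij.
Qed.

End EdgeDisjointPaths.

Theorem theorem2 (V : finType) (e : rel V) (hG : simple_graph e)
    (hdiam : has_diameter e 2) (v w : V) (hvw : v <> w) :
  let d := minn (degree e v) (degree e w) in
  exists P : 'I_d -> seq V,
    (forall i, graph_path e v w (P i) /\ size (P i) <= 4) /\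
    (forall i j, i <> j ->
       [disjoint path_edges v (P i) & path_edges v (P j)]).
Proof.
case: hG => e_sym e_irr; have vw : v != w by apply/eqP.
rewrite /= (min_degreeE v w e_sym e_irr).
set A := [set y | e v y & ~~ _]; set B := [set y | e w y & ~~ _].
set shared := [set y | _ & _ || _]; set m := minn _ _.
(* [A] and [B] are enumerated up to the smaller cardinality [m]; the permutation [s] below then
   reindexes [b0] optimally. *)
pose a (i : 'I_m) : V := enum_val (widen_ord (geq_minl #|A| #|B|) i).
pose b0 (i : 'I_m) : V := enum_val (widen_ord (geq_minr #|A| #|B|) i).
have widen_inj n (le : m <= n) : injective (widen_ord le).
  by move=> i j /(congr1 val) /= /val_inj.
have a_inj : injective a by move=> i j /enum_val_inj/widen_inj.
have b0_inj : injective b0 by move=> i j /enum_val_inj/widen_inj.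
have [s opt] := exists_unswappable_pairing e a b0.
have aA i : a i \in A by apply: enum_valP.
have bB i : b0 (s i) \in B by apply: enum_valP.
have b_inj : injective (fun i => b0 (s i)) by move=> i j /b0_inj/perm_inj.
(* The paths are indexed by a sum type; counting it lets ordinals below [#|shared| + m] serve as
   indices. *)
have card_I : #|shared| + m = #|{: {y | y \in shared} + 'I_m}|.
  by rewrite card_sum card_sig card_ord; congr (_ + _); apply: eq_card.
pose index (k : 'I_(#|shared| + m)) := enum_val (cast_ord card_I k).
exists (fun k => short_path a (fun i => b0 (s i)) (index k)); split=> [k|k l kl].
  exact: (short_path_graph_path e_sym e_irr hdiam vw aA bB).
apply: (short_paths_edge_disjoint e_sym e_irr hdiam vw a_inj b_inj aA bB opt).
by move/enum_val_inj/cast_ord_inj.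
Qed.
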